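(* Let $p$ be a positive and continuously differentiable probability density function on $\mathbb{R}^d$ and let $q$ be a distribution on $\mathbb{R}^d$. Let $\boldsymbol{K}(\boldsymbol{x},\boldsymbol{x}')$ be a matrix-valued positive definite kernel that is continuously differentiable on $\boldsymbol{x}$ and $\boldsymbol{x}'$, with associated vector-valued reproducing kernel Hilbert space $\mathcal{H}_{\boldsymbol{K}}$. Then the optimal $\boldsymbol{\phi}^*_{\boldsymbol{K}}$ in $$\boldsymbol{\phi}^*_{\boldsymbol{K}}=\operatorname*{arg\,max}_{\boldsymbol{\phi}\in\mathcal{H}_{\boldsymbol{K}}}\Big\{\mathbb{E}_{\boldsymbol{x}\sim q}\big[\mathcal{P}^\top\boldsymbol{\phi}(\boldsymbol{x})\big],\ \ \text{s.t.}\ \ \|\boldsymbol{\phi}\|_{\mathcal{H}_{\boldsymbol{K}}}\le 1\Big\}$$ is $$\boldsymbol{\phi}^*_{\boldsymbol{K}}(\cdot)\ \propto\ \mathbb{E}_{\boldsymbol{x}\sim q}\big[\boldsymbol{K}(\cdot,\boldsymbol{x})\mathcal{P}\big]=\mathbb{E}_{\boldsymbol{x}\sim q}\big[\boldsymbol{K}(\cdot,\boldsymbol{x})\nabla_{\boldsymbol{x}}\log p(\boldsymbol{x})+\boldsymbol{K}(\cdot,\boldsymbol{x})\nabla_{\boldsymbol{x}}\big],$$ where the Stein operator $\mathcal{P}$ and the derivative operator $\nabla_{\boldsymbol{x}}$ are formally viewed as $\mathbb{R}^d$-valued column vectors, and $\boldsymbol{K}(\cdot,\boldsymbol{x})\mathcal{P}$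 and $\boldsymbol{K}(\cdot,\boldsymbol{x})\nabla_{\boldsymbol{x}}$ are interpreted by the matrix multiplication rule. Therefore, $\boldsymbol{K}(\cdot,\boldsymbol{x})\mathcal{P}$ is an $\mathbb{R}^d$-valued column vector, whose $\ell$-th element is defined by $$\big(\boldsymbol{K}(\cdot,\boldsymbol{x})\mathcal{P}\big)_\ell=\sum_{m=1}^d\Big(K_{\ell,m}(\cdot,\boldsymbol{x})\,\nabla_{x^m}\log p(\boldsymbol{x})+\nabla_{x^m}K_{\ell,m}(\cdot,\boldsymbol{x})\Big),$$ where $K_{\ell,m}(\boldsymbol{x},\boldsymbol{x}')$ denotes the $(\ell,m)$-element of the matrix $\boldsymbol{K}(\boldsymbol{x},\boldsymbol{x}')$ and $x^m$ the $m$-th element of $\boldsymbol{x}$.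
   Context: The Stein operator $\mathcal{P}$ of $p$ acts on a vector field $\boldsymbol{\phi}=[\phi^1,\dots,\phi^d]^\top\colon\mathbb{R}^d\to\mathbb{R}^d$ by $$\mathcal{P}^\top\boldsymbol{\phi}(\boldsymbol{x})=\nabla_{\boldsymbol{x}}\log p(\boldsymbol{x})^\top\boldsymbol{\phi}(\boldsymbol{x})+\nabla_{\boldsymbol{x}}^\top\boldsymbol{\phi}(\boldsymbol{x}),\qquad \nabla_{\boldsymbol{x}}^\top\boldsymbol{\phi}=\sum_{\ell=1}^d\nabla_{x^\ell}\phi^\ell.$$ The vector $\boldsymbol{K}(\cdot,\boldsymbol{x})\nabla_{\boldsymbol{x}}$ has $\ell$-th element $\sum_{m=1}^d\nabla_{x^m}K_{\ell,m}(\cdot,\boldsymbol{x})$, the derivative being with respect to the second argument $\boldsymbol{x}$ of the kernel. A matrix-valued positive definite kernel is a function $\boldsymbol{K}\colon\mathbb{R}^d\times\mathbb{R}^d\to\mathbb{R}^{d\times d}$ that is symmetric, in that $\boldsymbol{K}(\boldsymbol{x},\boldsymbol{x}')=\boldsymbol{K}(\boldsymbol{x}',\boldsymbol{x})^\top$, and positive definite, in that $\sum_{i,j}\boldsymbol{c}_i^\top\boldsymbol{K}(\boldsymbol{x}_i,\boldsymbol{x}_j)\boldsymbol{c}_j\ge0$ for any $\{\boldsymbol{x}_i\}\subset\mathbb{R}^d$ and $\{\boldsymbol{c}_i\}\subset\mathbb{R}^d$. Its vector-valued reproducing kernel Hilbert space $\mathcal{H}_{\boldsymbol{K}}$ is the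 closure of the set of functions $\boldsymbol{f}(\boldsymbol{x})=\sum_i\boldsymbol{K}(\boldsymbol{x},\boldsymbol{x}_i)\boldsymbol{c}_i$, equipped with the inner product $\langle\boldsymbol{f},\boldsymbol{g}\rangle_{\mathcal{H}_{\boldsymbol{K}}}=\sum_{i,j}\boldsymbol{c}_i^\top\boldsymbol{K}(\boldsymbol{x}_i,\boldsymbol{x}_j)\boldsymbol{s}_j$ for $\boldsymbol{g}(\boldsymbol{x})=\sum_i\boldsymbol{K}(\boldsymbol{x},\boldsymbol{x}_i)\boldsymbol{s}_i$, and the corresponding norm. It has the reproducing property $\boldsymbol{f}(\boldsymbol{x})^\top\boldsymbol{c}=\langle\boldsymbol{f}(\cdot),\boldsymbol{K}(\cdot,\boldsymbol{x})\boldsymbol{c}\rangle_{\mathcal{H}_{\boldsymbol{K}}}$ for any $\boldsymbol{f}\in\mathcal{H}_{\boldsymbol{K}}$ and $\boldsymbol{c}\in\mathbb{R}^d$. The symbol $\propto$ means ''proportional to''.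
   Formalization: It is assumed that for every φ in H_K the partial derivatives in P^Tφ exist and P^Tφ is q-integrable, so that the objective is defined; uniqueness of the optimal φ* is claimed only when E_q[K(·,x)P] is not identically zero. *)

(* Defs.v *)
From HB Require Import structures.
From mathcomp Require Import all_boot all_order all_algebra.
From mathcomp Require Import all_classical all_reals all_analysis.

Set Implicit Arguments.
Unset Strict Implicit.
Unset Printing Implicit Defensive.

Import Order.TTheory GRing.Theory Num.Theory.
Import numFieldNormedType.Exports.

Local Open Scope classical_set_scope.
Local Open Scope ring_scope.

(* R^d is the space 'cV[R]_d of column vectors. *)

Notation borel_cV R d :=
  (g_sigma_algebraType (@open 'cV[R]_d)) (only parsing).

(* Lebesgue integral over R^d of a nonnegative Borel function, as the iterated
   integral over the coordinates (Tonelli's theorem). *)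
Fixpoint lebesgue_integral_cV (R : realType) (d : nat) :
    ('cV[R]_d -> \bar R) -> \bar R :=
  match d with
  | 0 => fun f => f 0
  | d'.+1 => fun f =>
      (\int[lebesgue_measure]_t
         lebesgue_integral_cV
           (fun x : 'cV[R]_d' => f (col_mx (t%:M : 'cV[R]_1) x)))%E
  end.

Definition continuously_differentiable (R : realType) (V : normedModType R)
    (f : V -> R) : Prop :=
  (forall x, differentiable f x) /\ (forall v, continuous (fun x => 'D_v f x)).

Definition argmax (T : Type) (R : realType) (A : set T) (F : T -> R) : set T :=
  [set a | A a /\ forall b, A b -> F b <= F a].

Section differential_operators.
Context {R : realType} {d : nat}.

Definition basis_vec (l : 'I_d) : 'cV[R]_d := delta_mx l 0.

Definition grad (f : 'cV[R]_d -> R) (x : 'cV[R]_d) : 'cV[R]_d :=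
  \col_l 'D_(basis_vec l) f x.

Definition divergence (phi : 'cV[R]_d -> 'cV[R]_d) (x : 'cV[R]_d) : R :=
  \sum_(l < d) 'D_(basis_vec l) (fun y => phi y l 0) x.

Definition score (p : 'cV[R]_d -> R) : 'cV[R]_d -> 'cV[R]_d :=
  grad (fun y => ln (p y)).

Definition stein (p : 'cV[R]_d -> R) (phi : 'cV[R]_d -> 'cV[R]_d)
    (x : 'cV[R]_d) : R :=
  ((score p x)^T *m phi x) 0 0 + divergence phi x.

(* All the partial derivatives occurring in [stein p phi] exist; without this,
   ['D_v] takes a junk value. *)
Definition stein_defined (phi : 'cV[R]_d -> 'cV[R]_d) : Prop :=
  forall (x : 'cV[R]_d) (l : 'I_d),
    derivable (fun y => phi y l 0) x (basis_vec l).

End differential_operators.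

Section kernels.
Context {R : realType} {d : nat}.
Implicit Types (K : 'cV[R]_d -> 'cV[R]_d -> 'M[R]_d).

Definition pd_kernel K : Prop :=
  (forall x y, K x y = (K y x)^T) /\
  (forall (n : nat) (x c : 'I_n -> 'cV[R]_d),
     0 <= \sum_(i < n) \sum_(j < n) ((c i)^T *m K (x i) (x j) *m c j) 0 0).

Definition C1_kernel K : Prop :=
  forall l m : 'I_d, continuously_differentiable
    (fun z : 'cV[R]_d * 'cV[R]_d => K z.1 z.2 l m).

(* [kernel_div K y x] is K(y, x) nabla_x: the derivative acts on the second
   argument of K. *)
Definition kernel_div K (y x : 'cV[R]_d) : 'cV[R]_d :=
  \col_l \sum_(m < d) 'D_(basis_vec m) (fun z => K y z l m) x.

(* [kernel_stein K p y x] is K(y, x) P. *)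
Definition kernel_stein K (p : 'cV[R]_d -> R) (y x : 'cV[R]_d) : 'cV[R]_d :=
  \col_l \sum_(m < d)
    (K y x l m * 'D_(basis_vec m) (fun z => ln (p z)) x
     + 'D_(basis_vec m) (fun z => K y z l m) x).

(* A list s of pairs (x_i, c_i) represents the function
   sum_i K(., x_i) c_i of the pre-Hilbert space spanned by the kernel. *)
Definition combo : Type := seq ('cV[R]_d * 'cV[R]_d).

Definition combo_fun K (s : combo) (y : 'cV[R]_d) : 'cV[R]_d :=
  \sum_(a <- s) K y a.1 *m a.2.

Definition combo_dot K (s t : combo) : R :=
  \sum_(a <- s) \sum_(b <- t) (a.2^T *m K a.1 b.1 *m b.2) 0 0.

Definition combo_sub (s t : combo) : combo :=
  s ++ [seq (b.1, - b.2) | b <- t].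

Definition combo_norm K (s : combo) : R := Num.sqrt (combo_dot K s s).

(* Since point evaluations are continuous for [combo_norm], the completion of
   the span of the kernel is realized as a space of functions: the pointwise
   limits of Cauchy sequences. *)
Definition rkhs_approx K (u : nat -> combo) (f : 'cV[R]_d -> 'cV[R]_d) : Prop :=
  (forall e : R, 0 < e -> exists N : nat, forall m n : nat,
     (N <= m)%N -> (N <= n)%N -> combo_norm K (combo_sub (u m) (u n)) < e) /\
  (forall y, (fun n => combo_fun K (u n) y) @ \oo --> f y).

Definition rkhs K : set ('cV[R]_d -> 'cV[R]_d) :=
  [set f | exists u, rkhs_approx K u f].

(* Extension of [combo_dot] by continuity; the limit depends neither on u nor
   on v, so [xget] selects from a singleton when f and g are in [rkhs K]. *)
Definition rkhs_dot K (f g : 'cV[R]_d -> 'cV[R]_d) : R :=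
  xget 0 [set r : R | exists u v, [/\ rkhs_approx K u f, rkhs_approx K v g
    & (fun n => combo_dot K (u n) (v n)) @ \oo --> r]].

Definition rkhs_norm K (f : 'cV[R]_d -> 'cV[R]_d) : R :=
  Num.sqrt (rkhs_dot K f f).

Definition rkhs_unit_ball K : set ('cV[R]_d -> 'cV[R]_d) :=
  [set f | rkhs K f /\ rkhs_norm K f <= 1].

End kernels.

Section expectations.
Context {R : realType} {d : nat} (q : probability (borel_cV R d) R).

Definition mean_vec (F : 'cV[R]_d -> 'cV[R]_d) : 'cV[R]_d :=
  \col_l \int[q]_x F x l 0.

Definition stein_objective (p : 'cV[R]_d -> R) (phi : 'cV[R]_d -> 'cV[R]_d) : R :=
  \int[q]_x stein p phi x.

(* The maximization problem is meaningful: the objective exists for every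
   phi in the RKHS.  Joint C^1 regularity of K alone does not ensure that the
   elements of the RKHS are differentiable (for d = 1, the RKHS of
   exp(-|x - x'|^(3/2)) contains a function not differentiable at 0); they are
   when the mixed derivatives of K in x and x' also exist and are continuous. *)
Definition stein_objective_exists K (p : 'cV[R]_d -> R) : Prop :=
  forall phi, rkhs K phi ->
    stein_defined phi /\
    q.-integrable [set: borel_cV R d] (fun x => (stein p phi x)%:E).

End expectations.

(* Main.v *)
Require Import Defs.
From HB Require Import structures.
From mathcomp Require Import all_boot all_order all_algebra.
From mathcomp Require Import all_classical all_reals all_analysis.
From mathcomp Require Import measurable_realfun ring lra.

(* The objective L is a linear functional on the RKHS H, and the only difficulty
   is its boundedness, which no hypothesis gives directly.  It comes from
   completeness, used twice through the fact that closed, midpoint-convex,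
   symmetric, absorbing sets contain a ball.  First, the difference quotients at
   a point are bounded functionals that converge on all of H, so the partial
   derivatives, and with them the Stein operator at each point, are bounded
   functionals.  Second, by Fatou's lemma {f | E_q |P^T f| <= 1} is then closed,
   so L is bounded.  By the Riesz theorem L f = <f, h>; testing on K(., y) e_l and
   using K(x, y) = K(y, x)^T shows h = E_q[K(., x) P].  The maximizer over the unit
   ball is h / |h|, unique by the equality case of Cauchy-Schwarz. *)

Set Implicit Arguments.
Unset Strict Implicit.
Unset Printing Implicit Defensive.

Import Order.TTheory GRing.Theory Num.Theory.
Import numFieldNormedType.Exports.

Local Open Scope classical_set_scope.
Local Open Scope ring_scope.

(** * Complete semi-inner products *)

(** The case [a = 0] must be covered because the forms below are only semi-definite; it forces
    [b = 0]. *)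
Lemma quadratic_ge0_disc (R : realFieldType) (a b c : R) :
  (forall t, 0 <= t ^+ 2 * a + 2 * t * b + c) -> 0 <= a -> b ^+ 2 <= a * c.
Proof.
move=> h; rewrite le_eqVlt => /predU1P[a0|a_gt0].
  subst a; rewrite mul0r.
  have [->|b0] := eqVneq b 0; first by rewrite expr0n.
  (* At this [t] the affine function [2 * t * b + c] equals -1. *)
  have := h (- (c + 1) / (2 * b)); rewrite mulr0 add0r.
  have -> : 2 * (- (c + 1) / (2 * b)) * b + c = - 1 by field.
  by rewrite lerNr oppr0 ler10.
(* The vertex of the parabola. *)
have := h (- b / a).
have -> : (- b / a) ^+ 2 * a + 2 * (- b / a) * b + c = (a * c - b ^+ 2) / a.
  by field; rewrite gt_eqF.
by rewrite pmulr_lge0 ?invr_gt0// subr_ge0.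
Qed.

Section inner_product.
Context {R : realType} {V : lmodType R}.
Implicit Types (A B : set V) (D : V -> V -> R) (L : V -> R).

Definition semi_norm D (f : V) : R := Num.sqrt (D f f).

(** The domain is a subset of an ambient module because [rkhs K] is a set of functions and
    [rkhs_dot] takes a default value outside it. *)
Record semi_inner A D : Prop := SemiInner {
  dom0 : A 0;
  domP : forall a f g, A f -> A g -> A (a *: f + g);
  dotC : forall f g, A f -> A g -> D f g = D g f;
  dotP : forall a f g h, A f -> A g -> A h ->
    D (a *: f + g) h = a * D f h + D g h;
  dot_ge0 : forall f, A f -> 0 <= D f f }.

Definition norm_complete A D : Prop := forall u : nat -> V,
  (forall n, A (u n)) ->
  (forall e : R, 0 < e -> exists N : nat, forall m n : nat,
     (N <= m)%N -> (N <= n)%N -> semi_norm D (u m - u n) < e) ->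
  exists2 f, A f & semi_norm D (u n - f) @[n --> \oo] --> 0.

Definition linear_on A L : Prop :=
  forall a f g, A f -> A g -> L (a *: f + g) = a * L f + L g.

Context {A : set V} {D : V -> V -> R} (inn : semi_inner A D).

Lemma domD f g : A f -> A g -> A (f + g).
Proof. by move=> Af Ag; rewrite -[f]scale1r; exact: (domP inn). Qed.

Lemma domZ a f : A f -> A (a *: f).
Proof. by move=> Af; rewrite -[_ *: _]addr0; exact: (domP inn _ Af (dom0 inn)). Qed.

Lemma domB f g : A f -> A g -> A (f - g).
Proof. by move=> Af Ag; rewrite addrC -scaleN1r; exact: (domP inn). Qed.

Lemma linear_on0 L : linear_on A L -> L 0 = 0.
Proof.
move=> Ll; have A0 := dom0 inn.
by have := Ll 1 _ _ A0 A0; rewrite scale1r addr0 mul1r => ?; lra.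
Qed.

Lemma linear_onZ L a f : linear_on A L -> A f -> L (a *: f) = a * L f.
Proof.
by move=> Ll Af; rewrite -[_ *: _]addr0 Ll ?linear_on0 ?addr0//; exact: (dom0 inn).
Qed.

Lemma linear_onB L f g : linear_on A L -> A f -> A g -> L (f - g) = L f - L g.
Proof. by move=> Ll Af Ag; rewrite addrC -scaleN1r Ll// mulN1r addrC. Qed.

Lemma dot_linearl h : A h -> linear_on A (D ^~ h).
Proof. by move=> Ah a f g Af Ag; exact: (dotP inn). Qed.

Lemma dot_linearr h : A h -> linear_on A (D h).
Proof.
move=> Ah a f g Af Ag.
by rewrite !(dotC inn Ah)//; [exact: (dotP inn)|exact: (domP inn)].
Qed.

Lemma sqr_semi_norm f : A f -> semi_norm D f ^+ 2 = D f f.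
Proof. by move=> Af; rewrite sqr_sqrtr// (dot_ge0 inn). Qed.

Lemma semi_norm_ge0 f : 0 <= semi_norm D f.
Proof. exact: sqrtr_ge0. Qed.

Lemma dotDD a f g : A f -> A g ->
  D (a *: f + g) (a *: f + g) = a ^+ 2 * D f f + 2 * a * D f g + D g g.
Proof.
move=> Af Ag; have Ah := domP inn a Af Ag.
rewrite (dotP inn)// (dot_linearr Af)// (dot_linearr Ag)// (dotC inn Ag Af).
ring.
Qed.

Lemma cauchy_schwarz f g : A f -> A g ->
  `|D f g| <= semi_norm D f * semi_norm D g.
Proof.
move=> Af Ag; rewrite -(@ler_pXn2r _ 2)// ?nnegrE ?mulr_ge0 ?semi_norm_ge0//.
rewrite exprMn !sqr_semi_norm// real_normK ?num_real//.
apply: quadratic_ge0_disc; last exact: (dot_ge0 inn).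
by move=> t; rewrite -dotDD// (dot_ge0 inn)//; exact: (domP inn).
Qed.

Lemma semi_normZ a f : A f -> semi_norm D (a *: f) = `|a| * semi_norm D f.
Proof.
move=> Af; rewrite /semi_norm (linear_onZ a (dot_linearl (domZ a Af)))//.
rewrite (linear_onZ a (dot_linearr Af))// mulrA -expr2 sqrtrM ?sqr_ge0//.
by rewrite sqrtr_sqr.
Qed.

Lemma semi_normBC f g : A f -> A g -> semi_norm D (f - g) = semi_norm D (g - f).
Proof.
move=> Af Ag; rewrite -[f - g]opprB -[- (g - f)]scaleN1r semi_normZ; last exact: domB.
by rewrite normrN1 mul1r.
Qed.

Lemma semi_norm_triangle f g : A f -> A g ->
  semi_norm D (f + g) <= semi_norm D f + semi_norm D g.
Proof.
move=> Af Ag; rewrite -(@ler_pXn2r _ 2)// ?nnegrE ?addr_ge0 ?semi_norm_ge0//.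
rewrite sqr_semi_norm; last exact: domD.
rewrite -[in leLHS](scale1r f) dotDD// sqrrD !sqr_semi_norm//.
rewrite expr1n mul1r mulr1 lerD2r lerD2l -[leRHS]mulr_natl ler_pM2l//.
exact: le_trans (ler_norm _) (cauchy_schwarz Af Ag).
Qed.

Lemma semi_norm_triangleB f g h : A f -> A g -> A h ->
  semi_norm D (f - g) <= semi_norm D (f - h) + semi_norm D (h - g).
Proof.
move=> Af Ag Ah; have -> : f - g = (f - h) + (h - g) by rewrite addrA subrK.
by apply: semi_norm_triangle; exact: domB.
Qed.

Lemma semi_norm0 : semi_norm D 0 = 0.
Proof. by rewrite /semi_norm (linear_on0 (dot_linearl (dom0 inn))) sqrtr0. Qed.

Lemma cvg_bounded_linear L C u f : linear_on A L ->
  (forall g, A g -> `|L g| <= C * semi_norm D g) ->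
  (forall n, A (u n)) -> A f ->
  semi_norm D (u n - f) @[n --> \oo] --> 0 -> L (u n) @[n --> \oo] --> L f.
Proof.
move=> Ll LC Au Af uf; apply/subr_cvg0/norm_cvg0P.
apply: (@squeeze_cvgr _ _ _ _ (fun=> 0) (fun n => C * semi_norm D (u n - f))).
- by near=> n; rewrite normr_ge0/= -(linear_onB Ll)//; apply/LC/domB.
- exact: cvg_cst.
- by rewrite -[X in _ --> X](mulr0 C); exact: cvgMr.
Unshelve. all: by end_near. Qed.

Lemma bounded_from_ball L r : linear_on A L -> 0 < r ->
  (forall f, A f -> semi_norm D f <= r -> `|L f| <= 1) ->
  forall f, A f -> `|L f| <= r^-1 * semi_norm D f.
Proof.
move=> Ll r0 Lr f Af; apply/ler_addgt0Pr => e e0.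
(* The slack [r * e] keeps the scaling factor of the next line defined when [f] has seminorm
   zero. *)
have s0 : 0 < semi_norm D f + r * e by rewrite ltr_wpDl ?semi_norm_ge0// mulr_gt0.
have a0 : 0 < r / (semi_norm D f + r * e) by rewrite divr_gt0.
have := Lr (r / (semi_norm D f + r * e) *: f) (domZ _ Af).
rewrite semi_normZ// linear_onZ// (normrM _ (L f)) (gtr0_norm a0).
rewrite (mulrAC r _ (semi_norm _ _)) (mulrAC r _ `|_|) !ler_pdivrMr// mul1r.
rewrite ler_pM2l// lerDl (mulr_ge0 (ltW r0) (ltW e0)) => /(_ isT) h.
by rewrite -(ler_pM2l r0) mulrDr mulrA divff ?gt_eqF// mul1r.
Qed.

(** * Consequences of completeness: a barrel theorem and Riesz representation *)

Hypothesis complete : norm_complete A D.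

(* Gliding nested balls: if no dilate of B contains a ball, the complements of
   the closed sets (k + 1)B are open and dense, and balls can be nested so as
   to leave each (k + 1)B in turn; their common point contradicts absorption. *)
Lemma barrel_contains_ball B :
  (forall u f, (forall n, A (u n)) -> A f -> (forall n, B (u n)) ->
     semi_norm D (u n - f) @[n --> \oo] --> 0 -> B f) ->
  (forall f g, A f -> A g -> B f -> B g -> B (2^-1 *: (f - g))) ->
  (forall f, A f -> exists k : nat, B (k.+1%:R^-1 *: f)) ->
  exists2 r, 0 < r & forall f, A f -> semi_norm D f <= r -> B f.
Proof.
move=> Bclosed Bconvex Babsorb; apply: contrapT => noball.
(* Closedness of (k + 1)B: if no ball around [f] missed it, points of it at distance at most 1/(n +
   1) would converge to [f]. *)
have separate k f : A f -> ~ B (k.+1%:R^-1 *: f) -> exists2 r, 0 < r &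
    forall h, A h -> semi_norm D (h - f) <= r -> ~ B (k.+1%:R^-1 *: h).
  move=> Af nBf; apply: contrapT => nsep; apply: nBf.
  have /choice[u uP] : forall n : nat, exists h, [/\ A h,
      semi_norm D (h - f) <= n.+1%:R^-1 & B (k.+1%:R^-1 *: h)].
    move=> n; apply: contrapT => nh; apply: nsep; exists n.+1%:R^-1 => //.
    by move=> h Ah hf Bh; apply: nh; exists h.
  apply: (Bclosed (fun n => k.+1%:R^-1 *: u n)).
  - by move=> n; apply: domZ; have [] := uP n.
  - exact: domZ.
  - by move=> n; have [] := uP n.
  - apply: (@squeeze_cvgr _ _ _ _ (fun=> 0)
      (fun n => `|k.+1%:R^-1| * n.+1%:R^-1)).
    + near=> n; have [Au uf _] := uP n.
      rewrite semi_norm_ge0/= -scalerBr semi_normZ; last exact: domB.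
      by rewrite ler_wpM2l.
    + exact: cvg_cst.
    + rewrite -[X in _ --> X](mulr0 `|k.+1%:R^-1|); apply: cvgMr.
      exact: cvg_harmonic.
(* One nesting step: inside the ball with centre [z.2.1] and radius [z.2.2], a ball of at most half
   the radius that misses (z.1 + 1)B. The pair (0, 0) is a dummy answer to invalid input. *)
have next (z : nat * (V * R)) : exists w : V * R, A z.2.1 -> 0 < z.2.2 ->
    [/\ A w.1, 0 < w.2, w.2 <= z.2.2 / 2, semi_norm D (w.1 - z.2.1) <= z.2.2 / 2 &
     forall h, A h -> semi_norm D (h - w.1) <= w.2 -> ~ B (z.1.+1%:R^-1 *: h)].
  case: z => k [f0 r] /=.
  have [Af0|nAf0] := pselect (A f0); last by exists (0, 0).
  have [r0|nr0] := pselect (0 < r); last by exists (0, 0).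
  have [f [Af ff0 nBf]] : exists f, [/\ A f, semi_norm D (f - f0) <= r / 2 &
      ~ B (k.+1%:R^-1 *: f)].
    apply: contrapT => nf; apply: noball.
    have inB f : A f -> semi_norm D (f - f0) <= r / 2 -> B (k.+1%:R^-1 *: f).
      by move=> Af ff0; apply: contrapT => nBf; apply: nf; exists f.
    exists (r / 2 / k.+1%:R); first by rewrite !divr_gt0.
    move=> f Af; rewrite ler_pdivlMr// => fr.
    have Aw : A (k.+1%:R *: f) := domZ _ Af.
    have wr : semi_norm D (k.+1%:R *: f) <= r / 2.
      by rewrite semi_normZ// normr_nat mulrC.
    (* If (k + 1)B filled the half-radius ball around [f0], then [f] would be half the difference of
       the points (f0 + (k + 1)f)/(k + 1) and (f0 - (k + 1)f)/(k + 1) of B, so B would contain a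
       ball around 0. *)
    have := Bconvex _ _ (domZ k.+1%:R^-1 (domD Af0 Aw))
                        (domZ k.+1%:R^-1 (domB Af0 Aw)).
    have -> : 2^-1 *: (k.+1%:R^-1 *: (f0 + k.+1%:R *: f) -
        k.+1%:R^-1 *: (f0 - k.+1%:R *: f)) = f.
      rewrite -scalerBr opprB [f0 + _]addrC addrACA subrr addr0.
      rewrite -mulr2n -(scaler_nat 2 (_ *: f)) !scalerA -[RHS]scale1r; congr (_ *: _).
      by field; rewrite -[1]/(1%:R) -natrD pnatr_eq0.
    apply; apply: inB.
    + exact: domD.
    + by rewrite [f0 + _]addrC addrK.
    + exact: domB.
    + rewrite [f0 - _]addrC addrK -[- _]sub0r semi_normBC ?subr0//.
      exact: (dom0 inn).
  have [r' r'0 sep] := separate _ _ Af nBf.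
  exists (f, Num.min r' (r / 2)) => _ _ /=; split => //.
  - by rewrite lt_min r'0 divr_gt0.
  - by rewrite ge_min lexx orbT.
  - by move=> h Ah; rewrite le_min => /andP[hf _]; exact: sep.
have [F FP] := choice next.
pose s n := iteri n (fun k w => F (k, w)) (0, 1).
have sA n : A (s n).1 /\ 0 < (s n).2.
  elim: n => [|n [IH1 IH2]]; first by split => //=; exact: (dom0 inn).
  by have [] := FP (n, s n) IH1 IH2.
have sS n : [/\ (s n.+1).2 <= (s n).2 / 2,
    semi_norm D ((s n.+1).1 - (s n).1) <= (s n).2 / 2 &
    forall h, A h -> semi_norm D (h - (s n.+1).1) <= (s n.+1).2 ->
      ~ B (n.+1%:R^-1 *: h)].
  by have [An rn] := sA n; have [] := FP (n, s n) An rn.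
(* The radii at least halve at each step; the harmonic bound suffices for the Cauchy property. *)
have s2 n : (s n).2 <= n.+1%:R^-1.
  elim: n => [|n IH]; first by rewrite invr1.
  have [h _ _] := sS n; apply: (le_trans h).
  apply: (@le_trans _ _ (n.+1%:R^-1 / 2)); first by rewrite ler_pM2r// invr_gt0.
  rewrite -invfM lef_pV2 ?posrE ?mulr_gt0// -natrM ler_nat.
  by rewrite muln2 -addnn addSn addnS !ltnS leq_addr.
(* Telescoping: each centre moves by at most half the old radius, hence by at most the decrease of
   the radius. *)
have nested m n : semi_norm D ((s (n + m)%N).1 - (s n).1) <= (s n).2 - (s (n + m)%N).2.
  elim: m => [|m IH]; first by rewrite addn0 !subrr semi_norm0.
  have [An _] := sA n; have [Am _] := sA (n + m)%N; have [ASm _] := sA (n + m.+1)%N.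
  apply: (le_trans (semi_norm_triangleB ASm An Am)); rewrite addnS.
  by have [] := sS (n + m)%N; lra.
have near_s m n : (n <= m)%N -> semi_norm D ((s m).1 - (s n).1) <= (s n).2.
  move=> nm; have := nested (m - n)%N n; rewrite subnKC//.
  by have [_] := sA m; lra.
have [|e e0|f Af sf] := complete (u := fun n => (s n).1).
- by move=> n; have [] := sA n.
- have e2 : 0 < e / 2 by rewrite divr_gt0.
  have [N _ HN] := near_infty_natSinv_lt (PosNum e2).
  exists N => m n Nm Nn; have [Am _] := sA m; have [An _] := sA n.
  have [AN _] := sA N; apply: (le_lt_trans (semi_norm_triangleB Am An AN)).
  have := HN N (leqnn N); rewrite /= (semi_normBC AN An).
  have := near_s _ _ Nm; have := near_s _ _ Nn; have := s2 N.
  move: (N.+1%:R^-1) => ?; lra.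
have sub_f n : semi_norm D (f - (s n).1) <= (s n).2.
  apply/ler_addgt0Pr => e e0.
  have /cvgrPdist_lt/(_ _ e0)[N _ HN] := sf.
  have := HN (maxn N n) (leq_maxl _ _); rewrite sub0r normrN ger0_norm ?semi_norm_ge0//.
  have := near_s (maxn N n) n (leq_maxr _ _).
  have [An _] := sA n; have [Am _] := sA (maxn N n).
  have := semi_norm_triangleB Af An Am; rewrite (semi_normBC Af Am); lra.
(* The common point lies in (k + 1)B for some k by absorption, yet also in ball k + 1, which misses
   that set. *)
have [k Bk] := Babsorb f Af; have [_ _ /(_ f Af (sub_f k.+1))] := sS k.
exact.
Unshelve. all: by end_near. Qed.

(** The representative is the limit of a minimizing sequence of [J f = D f f - 2 * L f], whose
    stationarity condition is [D h f = L h] for all [h]. *)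
Lemma riesz_representation L C : linear_on A L ->
  (forall f, A f -> `|L f| <= C * semi_norm D f) ->
  exists2 g, A g & forall f, A f -> L f = D f g.
Proof.
move=> Ll LC.
pose J f := D f f - 2 * L f.
(* Complete the square in |f|^2 - 2C|f|. *)
have J_lb f : A f -> - C ^+ 2 <= J f.
  move=> Af; rewrite /J -sqr_semi_norm//.
  have := le_trans (ler_norm _) (LC f Af).
  have := sqr_ge0 (semi_norm D f - C); nra.
have Jinf : has_inf [set J f | f in A].
  split; first by exists (J 0), 0 => //; exact: (dom0 inn).
  by exists (- C ^+ 2) => _ [f Af <-]; exact: J_lb.
pose m := inf [set J f | f in A].
have J_m f : A f -> m <= J f.
  by move=> Af; apply: ge_inf; [case: Jinf|exists f].
(* Approximate stationarity: [J (t *: h + f) >= m] for all [t] makes t^2 <h, h> + 2t(<h, f> - L h) +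
   d^2 nonnegative, and its discriminant gives the bound. *)
have almost d f h : 0 <= d -> A f -> A h -> J f <= m + d ^+ 2 ->
    `|D h f - L h| <= d * semi_norm D h.
  move=> d0 Af Ah Jf.
  rewrite -(@ler_pXn2r _ 2)// ?nnegrE ?mulr_ge0 ?semi_norm_ge0//.
  rewrite real_normK ?num_real// exprMn sqr_semi_norm// mulrC.
  apply: quadratic_ge0_disc; last exact: (dot_ge0 inn).
  move=> t; have := J_m _ (domP inn t Ah Af); rewrite /J dotDD// Ll//.
  by move: Jf; rewrite /J; lra.
(* The excess over the infimum is squared so that [almost] applies with [d] equal to 1/(n + 1). *)
have /choice[u uP] : forall n : nat, exists f, A f /\ J f <= m + n.+1%:R^-1 ^+ 2.
  move=> n; have e0 : 0 < n.+1%:R^-1 ^+ 2 :> R by rewrite exprn_gt0// invr_gt0.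
  by have [_ [f Af <-] /ltW] := inf_adherent e0 Jinf; exists f.
have uA n : A (u n) by have [] := uP n.
(* With h = f - g, |h|^2 = <h, f> - <h, g>, and both terms are within d|h| of [L h]. *)
have dist f g d : 0 <= d -> A f -> A g -> J f <= m + d ^+ 2 -> J g <= m + d ^+ 2 ->
    semi_norm D (f - g) <= 2 * d.
  move=> d0 Af Ag Jf Jg; have Afg := domB Af Ag.
  have := almost d f _ d0 Af Afg Jf; have := almost d g _ d0 Ag Afg Jg.
  set h := f - g in Afg *.
  have : semi_norm D h ^+ 2 = D h f - D h g.
    by rewrite sqr_semi_norm// -(linear_onB (dot_linearr Afg)).
  have := semi_norm_ge0 h; rewrite !ler_norml.
  rewrite le_eqVlt => /predU1P[<-|h0]; first by rewrite mulr_ge0.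
  move=> hh /andP[h1 _] /andP[_ h2].
  by rewrite -(ler_pM2r h0) -expr2; lra.
have [//|e e0|g Ag ug] := complete (u := u).
- have e2 : 0 < e / 2 by rewrite divr_gt0.
  have [N _ HN] := near_infty_natSinv_lt (PosNum e2).
  have uN k : (N <= k)%N -> J (u k) <= m + N.+1%:R^-1 ^+ 2.
    move=> Nk; have [_ /le_trans] := uP k; apply.
    by rewrite lerD2l lerXn2r ?nnegrE ?invr_ge0// lef_pV2 ?posrE// ler_nat ltnS.
  exists N => j k Nj Nk.
  have := dist _ _ _ _ (uA j) (uA k) (uN _ Nj) (uN _ Nk); rewrite invr_ge0 ler0n.
  move=> /(_ isT) /le_lt_trans; apply.
  by have := HN N (leqnn N); rewrite /=; move: (N.+1%:R^-1) => ?; lra.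
exists g => // f Af.
have Dlim : D f (u n) @[n --> \oo] --> D f g.
  apply: (cvg_bounded_linear (dot_linearr Af)) => // h Ah.
  exact: cauchy_schwarz.
have Llim : D f (u n) @[n --> \oo] --> L f.
  apply/subr_cvg0/norm_cvg0P.
  apply: (@squeeze_cvgr _ _ _ _ (fun=> 0)
    (fun n => n.+1%:R^-1 * semi_norm D f)).
  - near=> n; rewrite normr_ge0/=; apply: almost => //; last by have [] := uP n.
  - exact: cvg_cst.
  - by rewrite -[X in _ --> X](mul0r (semi_norm D f)); apply: cvgMl; exact: cvg_harmonic.
exact: cvg_unique Llim Dlim.
Unshelve. all: by end_near. Qed.

End inner_product.

(** * The reproducing kernel Hilbert space *)

Lemma cvg_mx_coordP (R : numFieldType) (m n : nat) (u : nat -> 'M[R]_(m, n))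
    (M : 'M[R]_(m, n)) :
  u k @[k --> \oo] --> M <-> forall i j, u k i j @[k --> \oo] --> M i j.
Proof.
split=> [uM i j U MU|uM U [P MP sPU]].
  apply: (uM [set N | U (N i j)]); exists (fun i' j' => if (i', j') == (i, j) then U else setT).
    by move=> i' j'; case: eqP => [[-> ->]//|_]; exact: filterT.
  by move=> N /(_ i j); rewrite eqxx.
suff : \forall k \near \oo, forall i j, P i j (u k i j).
  by apply: filterS => k /sPU.
by apply: filter_forall => i; apply: filter_forall => j; apply: uM; exact: MP.
Qed.

Lemma eq_seq_cvg (R : realType) (u v : nat -> R) (l : R) : u =1 v ->
  u n @[n --> \oo] --> l -> v n @[n --> \oo] --> l.
Proof. by move/funext => ->. Qed.

Lemma cauchy_seq_cvg (R : realType) (u : nat -> R) :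
  (forall e : R, 0 < e -> exists N : nat, forall m n : nat,
     (N <= m)%N -> (N <= n)%N -> `|u m - u n| < e) ->
  exists l : R, u n @[n --> \oo] --> l.
Proof.
move=> uC; suff /cvg_ex : cvgn u by [].
apply/cauchy_cvgP/cauchy_exP => e e0.
have [N HN] := uC e e0; exists (u N); exists N => // n Nn.
by rewrite -ball_normE; exact: HN.
Qed.

Section kernel_rkhs.
Context {R : realType} {d : nat}.
Implicit Types (s t w : @combo R d) (f g : 'cV[R]_d -> 'cV[R]_d).

(** The value that the reproducing property prescribes for the inner product of [combo_fun K s] with
    [f]. It is defined for every function and depends only on finitely many of its values, so it
    passes to pointwise limits. *)
Definition combo_pair s f : R := \sum_(a <- s) (a.2^T *m f a.1) 0 0.

Definition combo_lin (a : R) s t : combo := [seq (b.1, a *: b.2) | b <- s] ++ t.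

Lemma combo_pair_linear s a f g :
  combo_pair s (a *: f + g) = a * combo_pair s f + combo_pair s g.
Proof.
rewrite /combo_pair mulr_sumr -big_split/=; apply: eq_bigr => b _.
by rewrite /= mulmxDr -scalemxAr !mxE.
Qed.

Lemma combo_pairB s f g : combo_pair s (f - g) = combo_pair s f - combo_pair s g.
Proof. by rewrite addrC -scaleN1r combo_pair_linear mulN1r addrC. Qed.

Lemma combo_pair_sub s t f :
  combo_pair (combo_sub s t) f = combo_pair s f - combo_pair t f.
Proof.
rewrite /combo_pair /combo_sub big_cat big_map/= -sumrN; congr (_ + _).
by apply: eq_bigr => b _; rewrite linearN mulNmx mxE.
Qed.

Lemma combo_pair_coord y l c f :
  combo_pair [:: (y, c *: delta_mx l 0)] f = c * f y l 0.
Proof.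
rewrite /combo_pair big_seq1/= linearZ/= trmx_delta -scalemxAl mxE.
by rewrite -rowE mxE.
Qed.

Lemma combo_pair_cvg s (u : nat -> 'cV[R]_d -> 'cV[R]_d) f :
  (forall y, u n y @[n --> \oo] --> f y) ->
  combo_pair s (u n) @[n --> \oo] --> combo_pair s f.
Proof.
move=> uf; apply: (cvg_big add_continuous) => b _.
under eq_fun do rewrite mxE; rewrite mxE.
apply: (cvg_big add_continuous) => i _; apply: cvgMr.
exact: (cvg_mx_coordP _ _).1 (uf _) _ _.
Qed.

Context (K : 'cV[R]_d -> 'cV[R]_d -> 'M[R]_d).

Lemma combo_pair_fun s t : combo_pair s (combo_fun K t) = combo_dot K s t.
Proof.
apply: eq_bigr => a _; rewrite mulmx_sumr summxE.
by apply: eq_bigr => b _; rewrite mulmxA.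
Qed.

Lemma combo_fun_lin a s t :
  combo_fun K (combo_lin a s t) = a *: combo_fun K s + combo_fun K t.
Proof.
apply/funext => y; rewrite !fctE /combo_fun /combo_lin big_cat big_map/=.
by congr (_ + _); rewrite scaler_sumr; apply: eq_bigr => b _; rewrite -scalemxAr.
Qed.

Lemma combo_fun_sub s t :
  combo_fun K (combo_sub s t) = combo_fun K s - combo_fun K t.
Proof.
apply/funext => y; rewrite !fctE /combo_fun /combo_sub big_cat big_map/=.
by congr (_ + _); rewrite -sumrN; apply: eq_bigr => b _; rewrite mulmxN.
Qed.

Lemma combo_norm_ge0 s : 0 <= combo_norm K s.
Proof. exact: sqrtr_ge0. Qed.

Lemma combo_dotBr s t w :
  combo_dot K s (combo_sub t w) = combo_dot K s t - combo_dot K s w.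
Proof. by rewrite -!combo_pair_fun combo_fun_sub combo_pairB. Qed.

Lemma combo_dotBl s t w :
  combo_dot K (combo_sub t w) s = combo_dot K t s - combo_dot K w s.
Proof. by rewrite -!combo_pair_fun combo_pair_sub. Qed.

Lemma combo_dot_linr a s t w :
  combo_dot K s (combo_lin a t w) = a * combo_dot K s t + combo_dot K s w.
Proof. by rewrite -!combo_pair_fun combo_fun_lin combo_pair_linear. Qed.

Context (Kpd : pd_kernel K).

Lemma combo_dotC s t : combo_dot K s t = combo_dot K t s.
Proof.
rewrite /combo_dot exchange_big; apply: eq_bigr => b _; apply: eq_bigr => a _.
transitivity ((b.2^T *m K b.1 a.1 *m a.2)^T 0 0); last by rewrite mxE.
by rewrite !trmx_mul trmxK -Kpd.1 mulmxA.
Qed.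

Lemma combo_dot_ge0 s : 0 <= combo_dot K s s.
Proof.
pose x i := (tnth (in_tuple s) i).1; pose c i := (tnth (in_tuple s) i).2.
have := Kpd.2 _ x c; congr (0 <= _).
rewrite /combo_dot [RHS]big_tnth; apply: eq_bigr => i _.
by rewrite [RHS]big_tnth.
Qed.

Lemma sqr_combo_norm s : combo_norm K s ^+ 2 = combo_dot K s s.
Proof. by rewrite sqr_sqrtr// combo_dot_ge0. Qed.

Lemma combo_cauchy_schwarz s t :
  `|combo_dot K s t| <= combo_norm K s * combo_norm K t.
Proof.
rewrite -(@ler_pXn2r _ 2)// ?nnegrE ?mulr_ge0 ?combo_norm_ge0//.
rewrite exprMn !sqr_combo_norm real_normK ?num_real//.
apply: quadratic_ge0_disc => [x|]; last exact: combo_dot_ge0.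
have := combo_dot_ge0 (combo_lin x s t); rewrite combo_dot_linr.
rewrite ![combo_dot K (combo_lin x s t) _]combo_dotC !combo_dot_linr.
rewrite (combo_dotC t s); congr (0 <= _); ring.
Qed.

(** Testing at [t = s] suffices. This duality stands in for the triangle inequality on
    combinations. *)
Lemma combo_norm_le_dual s M : 0 <= M ->
  (forall t, `|combo_dot K s t| <= M * combo_norm K t) -> combo_norm K s <= M.
Proof.
move=> M0 /(_ s); rewrite -sqr_combo_norm ger0_norm ?sqr_ge0//.
have := combo_norm_ge0 s; rewrite le_eqVlt => /predU1P[<-//|s0].
by rewrite expr2 ler_pM2r.
Qed.

(** Cauchy-Schwarz bounds the pairing of [s] with [u m - u n]; letting m tend to infinity needs only
    pointwise convergence. The point is that [N] is uniform in [s]. *)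
Lemma rkhs_approx_dual u f e : rkhs_approx K u f -> 0 < e ->
  exists N, forall n s, (N <= n)%N ->
    `|combo_pair s f - combo_dot K s (u n)| <= e * combo_norm K s.
Proof.
move=> [uC uf] /uC[N HN]; exists N => n s Nn.
have : `|combo_pair s (combo_fun K (u m)) - combo_dot K s (u n)| @[m --> \oo] -->
    `|combo_pair s f - combo_dot K s (u n)|.
  apply: cvg_norm; apply: cvgB; last exact: cvg_cst.
  exact: combo_pair_cvg.
move=> /cvgr_to_le; apply; exists N => // m Nm /=.
rewrite combo_pair_fun -combo_dotBr mulrC.
apply: (le_trans (combo_cauchy_schwarz _ _)).
by rewrite ler_wpM2l ?combo_norm_ge0// ltW// HN.
Qed.

Lemma rkhs_approx_bounded u f : rkhs_approx K u f ->
  exists M N, forall n, (N <= n)%N -> combo_norm K (u n) <= M.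
Proof.
move=> [/(_ 1 ltr01)[N HN] _]; exists (1 + combo_norm K (u N)), N => n Nn.
apply: combo_norm_le_dual => [|t]; first by rewrite addr_ge0 ?combo_norm_ge0.
rewrite -[combo_dot K (u n) t](subrK (combo_dot K (u N) t)) -combo_dotBl mulrDl.
apply: (le_trans (ler_normD _ _)); apply: lerD; last exact: combo_cauchy_schwarz.
apply: (le_trans (combo_cauchy_schwarz _ _)).
by rewrite ler_wpM2r ?combo_norm_ge0// ltW// HN.
Qed.

(** The sequence [v] may be replaced by its pointwise limit, since [u] is bounded and
    [rkhs_approx_dual] is uniform over combinations. *)
Lemma rkhs_approx_dot_pair u v f g : rkhs_approx K u f -> rkhs_approx K v g ->
  combo_pair (u n) g - combo_dot K (u n) (v n) @[n --> \oo] --> 0.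
Proof.
move=> uf vg; have [M [N HM]] := rkhs_approx_bounded uf.
have M0 : 0 <= M := le_trans (combo_norm_ge0 _) (HM N (leqnn N)).
apply/norm_cvg0P/cvgr0Pnorm_le => e e0.
have e1 : 0 < e / (M + 1) by rewrite divr_gt0// ltr_wpDl.
have [N' HN'] := rkhs_approx_dual vg e1.
exists (maxn N N') => // n; rewrite /= geq_max => /andP[Nn N'n].
rewrite normr_id; apply: (le_trans (HN' _ _ N'n)).
rewrite mulrAC ler_pdivrMr ?ltr_wpDl// ler_pM2l//.
by rewrite (le_trans (HM _ Nn))// lerDl.
Qed.

(** One sequence is exchanged at a time: [v] and [v'] are both compared with their common limit [g],
    then symmetry handles [u] and [u']. *)
Lemma rkhs_approx_dot_unique u u' v v' f g :
  rkhs_approx K u f -> rkhs_approx K u' f ->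
  rkhs_approx K v g -> rkhs_approx K v' g ->
  combo_dot K (u n) (v n) - combo_dot K (u' n) (v' n) @[n --> \oo] --> 0.
Proof.
have half u1 v1 v2 f1 g1 : rkhs_approx K u1 f1 -> rkhs_approx K v1 g1 ->
    rkhs_approx K v2 g1 ->
    combo_dot K (u1 n) (v1 n) - combo_dot K (u1 n) (v2 n) @[n --> \oo] --> 0.
  move=> uf vg v'g; rewrite -[X in _ --> X](subr0 0).
  apply: eq_seq_cvg (cvgB (rkhs_approx_dot_pair uf v'g) (rkhs_approx_dot_pair uf vg)).
  by move=> n; rewrite /= !fctE; ring.
move=> uf u'f vg v'g; rewrite -[X in _ --> X](addr0 0).
apply: eq_seq_cvg (cvgD (half _ _ _ _ _ uf vg v'g) (half _ _ _ _ _ v'g uf u'f)).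
move=> n; rewrite /= !(combo_dotC (v' n)); ring.
Unshelve. all: by end_near. Qed.

Lemma rkhs_approx_dot_cvg u v f g : rkhs_approx K u f -> rkhs_approx K v g ->
  exists r : R, combo_dot K (u n) (v n) @[n --> \oo] --> r.
Proof.
move=> uf vg; have [M [N HM]] := rkhs_approx_bounded uf.
have [M' [N' HM']] := rkhs_approx_bounded vg.
have M0 : 0 <= M := le_trans (combo_norm_ge0 _) (HM N (leqnn N)).
have M'0 : 0 <= M' := le_trans (combo_norm_ge0 _) (HM' N' (leqnn N')).
apply: cauchy_seq_cvg => e e0.
have e1 : 0 < e / (M + M' + 1) by rewrite divr_gt0// ltr_wpDl// addr_ge0.
have [P HP] := uf.1 _ e1; have [P' HP'] := vg.1 _ e1.
exists (maxn (maxn N N') (maxn P P')) => m n; rewrite !geq_max.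
move=> /andP[/andP[Nm N'm] /andP[Pm P'm]] /andP[/andP[Nn N'n] /andP[Pn P'n]].
have -> : combo_dot K (u m) (v m) - combo_dot K (u n) (v n) =
    combo_dot K (combo_sub (u m) (u n)) (v m) + combo_dot K (u n) (combo_sub (v m) (v n)).
  by rewrite combo_dotBl combo_dotBr addrA subrK.
apply: (le_lt_trans (ler_normD _ _)).
apply: (@le_lt_trans _ _ (e / (M + M' + 1) * M' + M * (e / (M + M' + 1)))).
  apply: lerD; apply: (le_trans (combo_cauchy_schwarz _ _)); apply: ler_pM;
    rewrite ?combo_norm_ge0 ?HM ?HM'//; apply: ltW; [exact: HP|exact: HP'].
rewrite [M * _]mulrC -mulrDr mulrAC ltr_pdivrMr ?ltr_wpDl ?addr_ge0//.
by rewrite ltr_pM2l// addrC ltrDl.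
Qed.

(** [xget] picks the limit along some pair of approximating sequences; the given pair has the same
    limit. *)
Lemma rkhs_dot_cvg u v f g : rkhs_approx K u f -> rkhs_approx K v g ->
  combo_dot K (u n) (v n) @[n --> \oo] --> rkhs_dot K f g.
Proof.
move=> uf vg; have [r ur] := rkhs_approx_dot_cvg uf vg.
rewrite /rkhs_dot.
have : exists r, [set r : R | exists u v, [/\ rkhs_approx K u f, rkhs_approx K v g
    & (fun n => combo_dot K (u n) (v n)) @ \oo --> r]] r by exists r, u, v.
move=> /(xgetPex 0)[u' [v' [u'f v'g]]] u'v'.
rewrite -[X in _ --> X]addr0.
apply: eq_seq_cvg (cvgD u'v' (rkhs_approx_dot_unique uf u'f vg v'g)).
by move=> n; rewrite /=; ring.
Unshelve. all: by end_near. Qed.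

Lemma rkhs_dot_unique u v f g (r : R) : rkhs_approx K u f -> rkhs_approx K v g ->
  combo_dot K (u n) (v n) @[n --> \oo] --> r -> rkhs_dot K f g = r.
Proof. by move=> uf vg; apply: cvg_unique => //; exact: rkhs_dot_cvg. Qed.

Lemma rkhs_approx_cst s : rkhs_approx K (fun=> s) (combo_fun K s).
Proof.
split=> [e e0|y]; last exact: cvg_cst.
exists 0%N => _ _ _ _; rewrite /combo_norm combo_dotBr subrr sqrtr0//.
Qed.

Lemma rkhs_approx_lin a u v f g : rkhs_approx K u f -> rkhs_approx K v g ->
  rkhs_approx K (fun n => combo_lin a (u n) (v n)) (a *: f + g).
Proof.
move=> [uC uf] [vC vg]; split=> [e e0|y].
  have e1 : 0 < e / 2 / (`|a| + 1) by rewrite !divr_gt0// ltr_wpDl.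
  have e2 : 0 < e / 2 by rewrite divr_gt0.
  have [N HN] := uC _ e1; have [N' HN'] := vC _ e2.
  exists (maxn N N') => m n; rewrite !geq_max => /andP[Nm N'm] /andP[Nn N'n].
  have n1 := HN m n Nm Nn; have n2 := HN' m n N'm N'n.
  apply: (@le_lt_trans _ _ (`|a| * combo_norm K (combo_sub (u m) (u n)) +
      combo_norm K (combo_sub (v m) (v n)))); last first.
    rewrite [ltRHS]splitr; apply: ler_ltD => //.
    apply: (@le_trans _ _ (`|a| * (e / 2 / (`|a| + 1)))).
      by rewrite ler_wpM2l// ltW.
    rewrite mulrC mulrAC ler_pdivrMr ?ltr_wpDl//.
    by rewrite ler_wpM2l ?lerDl// ltW.
  apply: combo_norm_le_dual => [|t].
    by rewrite addr_ge0 ?mulr_ge0 ?combo_norm_ge0.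
  have -> : combo_dot K (combo_sub (combo_lin a (u m) (v m)) (combo_lin a (u n) (v n))) t =
      a * combo_dot K (combo_sub (u m) (u n)) t + combo_dot K (combo_sub (v m) (v n)) t.
    rewrite !combo_dotBl ![combo_dot K _ t]combo_dotC !combo_dot_linr; ring.
  rewrite mulrDl -mulrA; apply: (le_trans (ler_normD _ _)); rewrite normrM.
  by apply: lerD; [apply: ler_wpM2l => //|]; exact: combo_cauchy_schwarz.
under eq_fun do rewrite combo_fun_lin.
by apply: cvgD => //; exact: cvgZr.
Qed.

Lemma rkhs_combo s : rkhs K (combo_fun K s).
Proof. by exists (fun=> s); exact: rkhs_approx_cst. Qed.

Lemma rkhs_semi_inner : semi_inner (rkhs K) (rkhs_dot K).
Proof.
split.
- have -> : (0 : 'cV[R]_d -> 'cV[R]_d) = combo_fun K [::].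
    by apply/funext => y; rewrite /combo_fun big_nil.
  exact: rkhs_combo.
- by move=> a f g [u uf] [v vg]; exists (fun n => combo_lin a (u n) (v n)); exact: rkhs_approx_lin.
- move=> f g [u uf] [v vg]; apply: (rkhs_dot_unique uf vg).
  by apply: eq_seq_cvg (rkhs_dot_cvg vg uf) => n; exact: combo_dotC.
- move=> a f g h [u uf] [v vg] [w wh].
  apply: (rkhs_dot_unique (rkhs_approx_lin a uf vg) wh).
  apply: eq_seq_cvg (cvgD (cvgMr (rkhs_dot_cvg uf wh)) (rkhs_dot_cvg vg wh)) => n.
  by rewrite /= [RHS]combo_dotC combo_dot_linr !(combo_dotC (w _)).
- move=> f [u uf]; apply: cvgr_to_ge (rkhs_dot_cvg uf uf) _.
  by near=> n; exact: combo_dot_ge0.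
Unshelve. all: by end_near. Qed.

Lemma rkhs_norm_combo s : rkhs_norm K (combo_fun K s) = combo_norm K s.
Proof.
have ss := rkhs_approx_cst s; congr (Num.sqrt _).
by apply: (rkhs_dot_unique ss ss); exact: cvg_cst.
Qed.

(** The reproducing property, obtained by approximating [combo_fun K s] by the constant sequence. *)
Lemma combo_pair_rkhs s f : rkhs K f ->
  combo_pair s f = rkhs_dot K (combo_fun K s) f.
Proof.
move=> [u uf]; apply/esym; apply: (rkhs_dot_unique (rkhs_approx_cst s) uf).
under eq_fun do rewrite -combo_pair_fun.
by apply: combo_pair_cvg; case: uf.
Qed.

(** Approximating sequences converge in norm as well: |f - u_m|^2 is the limit over n of |u_n -
    u_m|^2. *)
Lemma rkhs_approx_norm u f e : rkhs_approx K u f -> 0 < e ->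
  exists N, forall n, (N <= n)%N -> rkhs_norm K (f - combo_fun K (u n)) <= e.
Proof.
move=> uf e0; have [N HN] := uf.1 _ e0; exists N => m Nm.
have := rkhs_approx_lin (-1) (rkhs_approx_cst (u m)) uf.
rewrite scaleN1r addrC => uNf.
rewrite -[leRHS]ger0_norm ?(ltW e0)// -sqrtr_sqr ler_wsqrtr//.
apply: cvgr_to_le (rkhs_dot_cvg uNf uNf) _; exists N => // n Nn /=.
have -> : combo_dot K (combo_lin (-1) (u m) (u n)) (combo_lin (-1) (u m) (u n)) =
    combo_norm K (combo_sub (u n) (u m)) ^+ 2.
  rewrite sqr_combo_norm combo_dotBl !combo_dotBr combo_dot_linr.
  rewrite ![combo_dot K (combo_lin _ _ _) _]combo_dotC !combo_dot_linr.
  rewrite (combo_dotC (u m)); ring.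
by rewrite lerXn2r ?nnegrE ?combo_norm_ge0 ?(ltW e0)// ltW// HN.
Qed.

Lemma rkhs_combo_dense f e : rkhs K f -> 0 < e ->
  exists s, rkhs_norm K (f - combo_fun K s) < e.
Proof.
move=> [u uf] e0; have e2 : 0 < e / 2 by rewrite divr_gt0.
have [N HN] := rkhs_approx_norm uf e2; exists (u N).
apply: (le_lt_trans (HN N (leqnn N))).
by rewrite ltr_pdivrMr// ltr_pMr// ltr1n.
Qed.

(** Cauchy-Schwarz against the representer K(., y) e_l of the evaluation. *)
Lemma rkhs_pointwise_bounded y l f : rkhs K f ->
  `|f y l 0| <= combo_norm K [:: (y, delta_mx l 0)] * rkhs_norm K f.
Proof.
move=> Hf; have := combo_pair_coord y l 1 f; rewrite scale1r mul1r => <-.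
rewrite combo_pair_rkhs// -rkhs_norm_combo.
apply: (cauchy_schwarz rkhs_semi_inner) => //; exact: rkhs_combo.
Qed.

(** Each [u n] is replaced by a combination within 1/(n + 1) of it. These combinations are Cauchy,
    hence converge at every point, and their pointwise limit belongs to [rkhs K] by definition. *)
Lemma rkhs_complete : norm_complete (rkhs K) (rkhs_dot K).
Proof.
move=> u Hu uC.
have /choice[s sP] : forall n, exists s, rkhs_norm K (u n - combo_fun K s) < n.+1%:R^-1.
  by move=> n; apply: rkhs_combo_dense => //; rewrite invr_gt0.
have Hs n := rkhs_combo (s n).
have inn := rkhs_semi_inner.
have sC (e : R) : 0 < e -> exists N : nat, forall m n : nat,
    (N <= m)%N -> (N <= n)%N -> combo_norm K (combo_sub (s m) (s n)) < e.
  move=> e0; have e3 : 0 < e / 3 by rewrite divr_gt0.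
  have [N HN] := uC _ e3.
  have [N' _ HN'] := near_infty_natSinv_lt (PosNum e3).
  exists (maxn N N') => m n; rewrite !geq_max => /andP[Nm N'm] /andP[Nn N'n].
  rewrite -rkhs_norm_combo combo_fun_sub.
  apply: (le_lt_trans (semi_norm_triangleB inn (Hs m) (Hs n) (Hu m))).
  rewrite (semi_normBC inn (Hs m) (Hu m)).
  rewrite [ltRHS](_ : _ = e / 3 + (e / 3 + e / 3)); last by field.
  apply: ltrD; first exact: lt_trans (sP m) (HN' m N'm).
  apply: (le_lt_trans (semi_norm_triangleB inn (Hu m) (Hs n) (Hu n))).
  by apply: ltrD; [exact: HN|exact: lt_trans (sP n) (HN' n N'n)].
have sy y l : exists r : R, combo_fun K (s n) y l 0 @[n --> \oo] --> r.
  apply: cauchy_seq_cvg => e e0.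
  set M := combo_norm K [:: (y, delta_mx l 0)].
  have M0 : 0 < M + 1 by rewrite ltr_wpDl ?combo_norm_ge0.
  have e1 : 0 < e / (M + 1) by rewrite divr_gt0.
  have [N HN] := sC _ e1; exists N => m n Nm Nn.
  have := @rkhs_pointwise_bounded y l _ (rkhs_combo (combo_sub (s m) (s n))).
  rewrite rkhs_norm_combo combo_fun_sub !mxE => /le_lt_trans; apply.
  apply: (@le_lt_trans _ _ (M * (e / (M + 1)))).
    by rewrite ler_wpM2l ?combo_norm_ge0// ltW// HN.
  by rewrite mulrCA gtr_pMr// ltr_pdivrMr// mul1r ltrDl.
have /choice[F FP] : forall z : 'cV[R]_d * 'I_d,
    exists r : R, combo_fun K (s n) z.1 z.2 0 @[n --> \oo] --> r by move=> z; exact: sy.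
pose f y : 'cV[R]_d := \col_l F (y, l).
have sf : rkhs_approx K s f.
  split=> // y; apply/cvg_mx_coordP => l j; rewrite mxE (ord1 j).
  exact: (FP (y, l)).
have Hf : rkhs K f by exists s.
exists f => //; apply/cvgr0Pnorm_le => e e0.
have e2 : 0 < e / 2 by rewrite divr_gt0.
have [N HN] := rkhs_approx_norm sf e2.
have [N' _ HN'] := near_infty_natSinv_lt (PosNum e2).
exists (maxn N N') => // n; rewrite /= geq_max => /andP[Nn N'n].
rewrite ger0_norm ?semi_norm_ge0//.
apply: (le_trans (semi_norm_triangleB inn (Hu n) Hf (Hs n))).
rewrite (semi_normBC inn (Hs n) Hf) [leRHS]splitr.
by apply: lerD; [exact: ltW (lt_trans (sP n) (HN' n N'n))|exact: HN].
Qed.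

End kernel_rkhs.

(** * The Stein functional *)

(** Steps 1/(n + 1) present the derivative as the limit of a sequence of functionals. *)
Lemma cvg_difference_quotient (R : realType) (V : normedModType R) (h : V -> R)
    (x v : V) : derivable h x v ->
  n.+1%:R * (h (n.+1%:R^-1 *: v + x) - h x) @[n --> \oo] --> 'D_v h x.
Proof.
move=> dh.
have /cvgr_dnbhsP/(_ (fun n => n.+1%:R^-1)) dhu := dh.
have := dhu (conj _ (@cvg_harmonic R)).
under eq_fun do rewrite invrK.
by apply=> n; rewrite invr_eq0 pnatr_eq0.
Qed.

Lemma derive_linear (R : realType) (V : normedModType R) (a : R)
    (h k : V -> R) (x v : V) :
  derivable h x v -> derivable k x v ->
  'D_v (fun y => a * h y + k y) x = a * 'D_v h x + 'D_v k x.
Proof.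
by move=> dh dk; rewrite (deriveD (derivableZ dh) dk) (deriveZ _ dh).
Qed.

Section stein_functional.
Context {R : realType} {d : nat}.
Context (K : 'cV[R]_d -> 'cV[R]_d -> 'M[R]_d) (Kpd : pd_kernel K).
Implicit Types (f g : 'cV[R]_d -> 'cV[R]_d) (x y v : 'cV[R]_d) (l : 'I_d).

Let inn := rkhs_semi_inner Kpd.
Let complete := rkhs_complete Kpd.

Lemma derive_coord_linear a f g x v l :
  derivable (fun y => f y l 0) x v -> derivable (fun y => g y l 0) x v ->
  'D_v (fun y => (a *: f + g) y l 0) x =
    a * 'D_v (fun y => f y l 0) x + 'D_v (fun y => g y l 0) x.
Proof.
move=> df dg; rewrite -derive_linear//; congr ('D_v _ x).
by apply/funext => y; rewrite !fctE !mxE.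
Qed.

Definition difference_quotient x v l (n : nat) f : R :=
  n.+1%:R * (f (n.+1%:R^-1 *: v + x) l 0 - f x l 0).

Lemma difference_quotient_linear x v l n :
  linear_on (rkhs K) (difference_quotient x v l n).
Proof. by move=> a f g _ _; rewrite /difference_quotient !fctE !mxE; ring. Qed.

Lemma rkhs_eval_cvg (u : nat -> 'cV[R]_d -> 'cV[R]_d) f y l :
  (forall n, rkhs K (u n)) -> rkhs K f ->
  semi_norm (rkhs_dot K) (u n - f) @[n --> \oo] --> 0 ->
  u n y l 0 @[n --> \oo] --> f y l 0.
Proof.
move=> Hu Hf; apply: (@cvg_bounded_linear _ _ _ _ inn (fun f => f y l 0)) => //.
- by move=> a h k _ _; rewrite !fctE !mxE.
- by move=> h Hh; exact: rkhs_pointwise_bounded.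
Qed.

(* Banach-Steinhaus: the difference quotients are bounded functionals that
   converge pointwise on the RKHS. *)
Lemma rkhs_derive_bounded x v l :
  (forall f, rkhs K f -> derivable (fun y => f y l 0) x v) ->
  exists C, forall f, rkhs K f ->
    `|'D_v (fun y => f y l 0) x| <= C * rkhs_norm K f.
Proof.
move=> der.
pose Q := difference_quotient x v l.
have Qlin n : linear_on (rkhs K) (Q n) := difference_quotient_linear x v l n.
have Qcvg f : rkhs K f -> Q n f @[n --> \oo] --> 'D_v (fun y => f y l 0) x.
  by move=> Hf; exact: (cvg_difference_quotient (der f Hf)).
have [||f Hf|r r0 rB] := barrel_contains_ball inn complete
    (B := [set f | forall n, `|Q n f| <= 1]).
- move=> u f Hu Hf Bu uf n.
  have Qu : `|Q n (u k)| @[k --> \oo] --> `|Q n f|.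
    rewrite /Q /difference_quotient; apply: cvg_norm; apply: cvgMr.
    by apply: cvgB; exact: rkhs_eval_cvg.
  by apply: cvgr_to_le Qu _; near=> k; exact: Bu.
- move=> f g Hf Hg Bf Bg n.
  rewrite (linear_onZ inn _ (Qlin n)) ?(linear_onB (Qlin n))//; last exact: (domB inn Hf Hg).
  rewrite normrM gtr0_norm ?invr_gt0// mulrC ler_pdivrMr// mul1r.
  by apply: (le_trans (ler_normB _ _)); apply: lerD.
(* Absorption: the quotients of a fixed [f] converge, so they are bounded in [n]. *)
- have [M [_ HM]] := cvg_seq_bounded (cvgP _ (Qcvg f Hf)).
  have [k Mk] : exists k : nat, M < k.+1%:R.
    by exists (Num.trunc M); rewrite truncnS_gt.
  exists k => n; rewrite (linear_onZ inn _ (Qlin n))// normrM gtr0_norm ?invr_gt0//.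
  by rewrite mulrC ler_pdivrMr// mul1r; exact: HM.
exists r^-1; apply: (bounded_from_ball inn _ r0).
  by move=> a f g Hf Hg; apply: derive_coord_linear; exact: der.
move=> f Hf fr; apply: (cvgr_to_le (cvg_norm (Qcvg f Hf))).
by near=> n; exact: rB.
Unshelve. all: by end_near. Qed.

(** * The Stein operator and its expectation as functionals on the RKHS *)

Context (p : 'cV[R]_d -> R) (q : probability (borel_cV R d) R).
Hypothesis obj_exists : stein_objective_exists q K p.

Lemma stein_linear x : linear_on (rkhs K) (stein p ^~ x).
Proof.
move=> a f g Hf Hg; have [df _] := obj_exists Hf; have [dg _] := obj_exists Hg.
have divE : divergence (a *: f + g) x = a * divergence f x + divergence g x.
  rewrite /divergence mulr_sumr -big_split; apply: eq_bigr => l _ /=.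
  by apply: derive_coord_linear; [exact: df|exact: dg].
rewrite /stein divE !fctE mulmxDr -scalemxAr !mxE; ring.
Qed.

Lemma stein_bounded x :
  exists C, forall f, rkhs K f -> `|stein p f x| <= C * rkhs_norm K f.
Proof.
have /choice[C1 HC1] : forall l, exists C, forall f, rkhs K f ->
    `|'D_(basis_vec l) (fun y => f y l 0) x| <= C * rkhs_norm K f.
  by move=> l; apply: rkhs_derive_bounded => f Hf; have [+ _] := obj_exists Hf; exact.
pose C2 l := combo_norm K [:: (x, delta_mx l 0)].
exists (\sum_l `|(score p x)^T 0 l| * C2 l + \sum_l C1 l) => f Hf.
rewrite mulrDl !mulr_suml; apply: (le_trans (ler_normD _ _)); apply: lerD.
  rewrite mxE; apply: (le_trans (ler_norm_sum _ _ _)); apply: ler_sum => l _.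
  by rewrite normrM -mulrA ler_wpM2l//; exact: rkhs_pointwise_bounded.
by apply: (le_trans (ler_norm_sum _ _ _)); apply: ler_sum => l _; exact: HC1.
Qed.

Lemma stein_objective_linear : linear_on (rkhs K) (stein_objective q p).
Proof.
move=> a f g Hf Hg; have [_ qf] := obj_exists Hf; have [_ qg] := obj_exists Hg.
rewrite /stein_objective -RintegralZl// -RintegralD//; last first.
  by under [X in q.-integrable _ X]eq_fun do rewrite /= EFinM; exact: integrableZl.
by apply: eq_Rintegral => x _; exact: stein_linear.
Qed.

Lemma measurable_norm_stein f : rkhs K f ->
  measurable_fun [set: borel_cV R d] (fun x => `|stein p f x|%:E).
Proof.
move=> Hf; have [_ qf] := obj_exists Hf.
apply/measurable_EFinP; apply: measurableT_comp => //.
by apply/measurable_EFinP; exact: (measurable_int q qf).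
Qed.

(** The constants of [stein_bounded] depend on [x] with no control of their integral over [q], so a
    second barrel argument is made, on the integral of the absolute value, to which Fatou's lemma
    applies. *)
Lemma stein_objective_bounded :
  exists C, forall f, rkhs K f -> `|stein_objective q p f| <= C * rkhs_norm K f.
Proof.
have [||f Hf|r r0 rB] := barrel_contains_ball inn complete
    (B := [set f | (\int[q]_x `|stein p f x|%:E <= 1)%E]).
- move=> u f Hu Hf Bu uf /=.
  (* Norm convergence of [u] gives convergence of the Stein operator at each [x], so the integrand
     for [f] is a lower limit. *)
  have lim_stein (x : borel_cV R d) :
      limn_einf (fun n => `|stein p (u n) x|%:E) = `|stein p f x|%:E.
    have [C HC] := stein_bounded x.
    have ux : `|stein p (u n) x|%:E @[n --> \oo] --> `|stein p f x|%:E.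
      apply: cvg_EFin; first by near=> n.
      apply: cvg_norm.
      exact: (cvg_bounded_linear inn (stein_linear x) HC).
    by rewrite is_cvg_limn_einfE; [exact: cvg_lim|exact: cvgP ux].
  rewrite (_ : (\int[q]_x _)%E =
      (\int[q]_x limn_einf (fun n => `|stein p (u n) x|%:E))%E); last first.
    by apply: eq_integral => x _; rewrite lim_stein.
  apply: (le_trans (fatou q measurableT (fun n => measurable_norm_stein (Hu n))
    (fun n x _ => normr_ge0 (stein p (u n) x)))).
  rewrite limn_einf_lim; apply: lime_le; first exact: is_cvg_einfs.
  near=> n; apply: (le_trans _ (Bu n)); apply: ereal_inf_lbound.
  by exists n => //=.
- move=> f g Hf Hg Bf Bg /=.
  have Hh : rkhs K (2^-1 *: (f - g)) := domZ inn _ (domB inn Hf Hg).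
  have mf := measurable_norm_stein Hf; have mg := measurable_norm_stein Hg.
  apply: (@le_trans _ _ (\int[q]_x (2^-1%:E * (`|stein p f x|%:E + `|stein p g x|%:E))))%E.
    apply: ge0_le_integral => //.
    + exact: measurable_norm_stein.
    + exact: (measurable_funeM _ (emeasurable_funD mf mg)).
    + move=> x _; rewrite -EFinD -EFinM lee_fin.
      have Sl := stein_linear x.
      rewrite (linear_onZ inn _ Sl (domB inn Hf Hg)) (linear_onB Sl Hf Hg).
      by rewrite normrM gtr0_norm ?invr_gt0// ler_wpM2l ?invr_ge0// ler_normB.
  rewrite ge0_integralZl_EFin ?invr_ge0//; last 2 first.
  + by move=> x _; rewrite -EFinD lee_fin addr_ge0.
  + exact: emeasurable_funD.
  rewrite ge0_integralD//.
  move: Bf Bg => /=; move: (\int[q]_x _)%E (\int[q]_x _)%E => a b a1 b1.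
  apply: (@le_trans _ _ (2^-1%:E * (1 + 1)))%E.
    by apply: lee_wpmul2l; [rewrite lee_fin invr_ge0|exact: leeD].
  by rewrite -EFinD -EFinM lee_fin mulVf.
(* Absorption: the integral is finite, and division by any larger [k.+1] brings it below 1. *)
- have [_ /integrableP[_ qf]] := obj_exists Hf.
  have I0 : (0 <= \int[q]_x `|stein p f x|%:E)%E by apply: integral_ge0 => x _; rewrite lee_fin.
  pose M := fine (\int[q]_x `|stein p f x|%:E)%E.
  have ME : (\int[q]_x `|stein p f x|%:E)%E = M%:E by rewrite fineK// ge0_fin_numE.
  have [k Mk] : exists k : nat, M < k.+1%:R.
    by exists (Num.trunc M); rewrite truncnS_gt.
  exists k => /=; under eq_integral => x _.
    rewrite (linear_onZ inn _ (stein_linear x) Hf) normrM gtr0_norm ?invr_gt0// EFinM.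
    over.
  rewrite ge0_integralZl_EFin ?invr_ge0//; last exact: measurable_norm_stein.
  by rewrite ME -EFinM lee_fin mulrC ler_pdivrMr// mul1r ltW.
exists r^-1; apply: (bounded_from_ball inn stein_objective_linear r0) => f Hf fr.
have [_ qf] := obj_exists Hf.
apply: (le_trans (le_normr_Rintegral _ _)) => //.
have I1 := rB f Hf fr.
have I0 : (0 <= \int[q]_x `|stein p f x|%:E)%E by apply: integral_ge0 => x _; rewrite lee_fin.
rewrite /Rintegral -[1]/(fine 1%E) fine_le// ge0_fin_numE//.
exact: le_lt_trans I1 (ltry _).
Unshelve. all: by end_near. Qed.

(** By symmetry of the kernel, row [l] of K(y, z) is K(z, y) e_l, so each coordinate of K(y, x)P is
    the Stein operator applied to an element of the RKHS. *)
Lemma kernel_stein_coord y x l :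
  kernel_stein K p y x l 0 = stein p (combo_fun K [:: (y, delta_mx l 0)]) x.
Proof.
have coordE z m : combo_fun K [:: (y, delta_mx l 0)] z m 0 = K y z l m.
  by rewrite /combo_fun big_seq1/= -colE mxE Kpd.1 mxE.
rewrite /kernel_stein /stein !mxE big_split /=; congr (_ + _).
  by apply: eq_bigr => m _; rewrite coordE !mxE mulrC.
by apply: eq_bigr => m _; congr ('D_ _ _ _); apply/funext => z; rewrite coordE.
Qed.

(* The Riesz representative of the objective is read off by testing it on the
   functions K(., y) e_l. *)
Lemma stein_objective_riesz :
  let g := fun y => mean_vec q (fun x => kernel_stein K p y x) in
  rkhs K g /\ forall f, rkhs K f -> stein_objective q p f = rkhs_dot K f g.
Proof.
move=> g; have [C HC] := stein_objective_bounded.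
have [h Hh hE] := riesz_representation inn complete stein_objective_linear HC.
suff -> : g = h by [].
apply/funext => y; apply/colP => l; rewrite mxE.
transitivity (stein_objective q p (combo_fun K [:: (y, delta_mx l 0)])).
  by apply: eq_Rintegral => x _; rewrite kernel_stein_coord.
rewrite hE; last exact: rkhs_combo.
by rewrite -(combo_pair_rkhs Kpd)// -[delta_mx l 0]scale1r combo_pair_coord mul1r.
Qed.

End stein_functional.

(** * The maximizer over the unit ball and its uniqueness *)

Theorem theorem1 (R : realType) (d : nat)
    (p : 'cV[R]_d -> R)
    (p_gt0 : forall x, 0 < p x)
    (p_C1 : continuously_differentiable p)
    (p_density : lebesgue_integral_cV (fun x => (p x)%:E) = 1%E)
    (q : probability (borel_cV R d) R)
    (K : 'cV[R]_d -> 'cV[R]_d -> 'M[R]_d)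
    (K_pd : pd_kernel K)
    (K_C1 : C1_kernel K)
    (obj_exists : stein_objective_exists q K p) :
  let g := fun y => mean_vec q (fun x => kernel_stein K p y x) in
  let optimal := argmax (rkhs_unit_ball K) (stein_objective q p) in
  [/\ (forall (y : 'cV[R]_d) (l : 'I_d),
        q.-integrable [set: borel_cV R d]
          (fun x => (kernel_stein K p y x l 0)%:E)),
      (forall y : 'cV[R]_d,
        g y = mean_vec q (fun x => K y x *m score p x + kernel_div K y x)) &
      exists c : R, [/\ 0 < c,
        optimal (fun y => c *: g y) &
        g <> (fun=> 0) ->
        forall phi, optimal phi -> phi = (fun y => c *: g y)]].
Proof.
move=> g optimal; split.
- move=> y l; under eq_fun do rewrite (kernel_stein_coord K_pd).
  by have [_] := obj_exists _ (rkhs_combo K [:: (y, delta_mx l 0)]).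
- move=> y; apply/colP => l; rewrite !mxE; apply: eq_Rintegral => x _.
  rewrite !mxE big_split/=; congr (_ + _).
  by apply: eq_bigr => m _; rewrite mxE.
have [Hg LE] := stein_objective_riesz K_pd obj_exists; rewrite -/g in Hg LE.
have inn := rkhs_semi_inner K_pd.
(* The seminorm dominates all evaluations, hence is a norm on the RKHS. *)
have definite f : rkhs K f -> rkhs_norm K f = 0 -> f = fun=> 0.
  move=> Hf f0; apply/funext => y; apply/colP => l; rewrite mxE.
  apply/eqP; rewrite -normr_le0.
  by have := rkhs_pointwise_bounded K_pd y l Hf; rewrite f0 mulr0.
have normE f : rkhs K f -> rkhs_dot K f f = rkhs_norm K f ^+ 2.
  by move=> Hf; rewrite -(sqr_semi_norm inn).
have upper f : rkhs_unit_ball K f -> stein_objective q p f <= rkhs_norm K g.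
  move=> [Hf f1]; rewrite LE//; apply: (le_trans (ler_norm _)).
  apply: (le_trans (cauchy_schwarz inn Hf Hg)).
  by rewrite -[leRHS]mul1r ler_wpM2r ?sqrtr_ge0.
(* If g = 0, the objective vanishes on the RKHS and every point of the ball is optimal; [c = 1] is
   an arbitrary positive choice. *)
have [g0|gN0] := eqVneq (rkhs_norm K g) 0.
  exists 1; have gE := definite _ Hg g0.
  have -> : (fun y => 1 *: g y) = g by apply/funext => y; rewrite scale1r.
  split; [exact: ltr01| |by move=> /(_ gE)].
  split; first by split; [exact: Hg|rewrite g0 ler01].
  by move=> f /upper; rewrite g0 (LE g Hg) (normE g Hg) g0 expr0n.
have g_gt0 : 0 < rkhs_norm K g by rewrite lt_neqAle eq_sym gN0 sqrtr_ge0.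
have [c c0 cg1] : exists2 c, 0 < c & c * rkhs_norm K g = 1.
  by exists (rkhs_norm K g)^-1; rewrite ?invr_gt0 ?mulVf.
have Hcg : rkhs K (c *: g) := domZ inn c Hg.
have Lcg : stein_objective q p (c *: g) = rkhs_norm K g.
  rewrite LE// (linear_onZ inn _ (dot_linearl inn Hg))// normE//.
  by rewrite expr2 mulrA cg1 mul1r.
have ball_cg : rkhs_unit_ball K (c *: g).
  split=> //; rewrite /rkhs_norm -/(semi_norm _ _) (semi_normZ inn)// gtr0_norm//.
  by rewrite -/(rkhs_norm K g) cg1.
exists c; split; first exact: c0.
  split; first exact: ball_cg.
  by move=> f /upper/le_trans; apply; rewrite -[leLHS]Lcg; exact: lexx.
move=> _ phi [[Hphi phi1] /(_ _ ball_cg)]; rewrite Lcg (LE phi Hphi) => phi_max.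
(* Equality case of Cauchy-Schwarz: |phi - cg|^2 = 1 - 2c<phi, g> + |phi|^2 is at most 0, because
   |phi| <= 1 and optimality gives c<phi, g> >= c|g| = 1. *)
suff : - c *: g + phi = fun=> 0.
  move=> h; apply/funext => y; apply/eqP; rewrite -subr_eq0 addrC -scaleNr.
  exact/eqP/(congr1 (@^~ y) h).
have Hdiff : rkhs K (- c *: g + phi) := domP inn _ Hg Hphi.
apply: (definite _ Hdiff); apply/eqP.
rewrite -sqrf_eq0 -(normE _ Hdiff) eq_le (dot_ge0 inn Hdiff) andbT.
rewrite (dotDD inn _ Hg Hphi) (dotC inn Hg Hphi) (normE g Hg) (normE phi Hphi).
rewrite sqrrN -exprMn cg1 expr1n.
have : rkhs_norm K phi ^+ 2 <= 1 := exprn_ile1 2 (sqrtr_ge0 _) phi1.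
have : 1 <= c * rkhs_dot K phi g by rewrite -cg1 ler_pM2l.
by move: (rkhs_dot K phi g) (rkhs_norm K phi ^+ 2) => u w {phi_max phi1}; lra.
Qed.
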